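(* Let $G$ and $H$ be finite connected graphs such that $\mathrm{drm}(G)\neq\mathrm{drm}(H)$, there is a locally injective homomorphism $G\to H$, and $H$ has no vertices of degree $1$. Then: (a) There exists a connected graph $F$ such that $G<^{LI}F<^{LI}H$, $\mathrm{drm}(F)\neq\mathrm{drm}(G)$ and $\mathrm{drm}(F)\neq\mathrm{drm}(H)$. (b) When $G$ has no vertices of degree $1$ and $H$ has at least one cycle with a vertex of degree greater than $2$, then $F$ can be chosen to have, in addition, no vertices of degree $1$ and to contain a cycle with a vertex of degree greater than $2$.
   Context: Graphs are finite, nonempty and undirected, loops allowed. $N_G(v)$ is the set of vertices adjacent to $v$ (containing $v$ iff $v$ has a loop), and the degree of $v$ is $|N_G(v)|$. Cycles have at least three distinct vertices. A graph homomorphism $f:G\to H$ is locally injective if for every $v\in V_G$ the restriction of $f$ to $N_G(v)\to N_H(f(v))$ is injective. $G\leq^{LI}H$ means there is a locally injective homomorphism $G\to H$, and $G<^{LI}H$ means $G\leq^{LI}H$ and not $H\leq^{LI}G$. An equitable partition of $G$ is a partition $B_1,\dots,B_k$ of $V_G$ such that for all $i,j$ every vertex $u\in B_i$ has the same number $m_{i,j}=|N_G(u)\cap B_j|$ of neighbours in $B_j$. Every finite graph has a unique coarsest equitable partition; its matrix $(m_{i,j})$, with blocks canonically ordered, is the degree refinement matrix $\mathrm{drm}(G)$ (so $\mathrm{drm}(G)=\mathrm{drm}(H)$ means these matrices agree up to a simultaneous permutation of rows and columns). *)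

(* Defs.v *)
From mathcomp Require Import all_boot matrix.

Set Implicit Arguments.
Unset Strict Implicit.
Unset Printing Implicit Defensive.

(* Finite, nonempty, undirected graphs; irreflexivity is not required, so
   loops are allowed. *)
Record graph := Graph {
  vertex :> finType;
  adj : rel vertex;
  adj_sym : symmetric adj;
  vertex_gt0 : 0 < #|vertex|
}.

(* A loop at v puts v in its own neighbourhood, and thus contributes 1 to the
   degree. *)
Definition nbr (G : graph) (v : G) : {set G} := [set w | adj v w].

Definition deg (G : graph) (v : G) : nat := #|nbr v|.

Definition connected (G : graph) : Prop := forall u v : G, connect (@adj G) u v.

Definition no_deg1 (G : graph) : Prop := forall v : G, deg v <> 1.

Definition is_cycle (G : graph) (c : seq G) : bool :=
  (3 <= size c) && ucycleb (@adj G) c.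

Definition has_cycle_deg_gt2 (G : graph) : Prop :=
  exists c : seq G, is_cycle c /\ exists2 v, v \in c & 2 < deg v.

Definition homomorphism (G H : graph) (f : G -> H) : Prop :=
  forall u v : G, adj u v -> adj (f u) (f v).

Definition locally_injective (G H : graph) (f : G -> H) : Prop :=
  forall v : G, {in nbr v &, injective f}.

Definition leLI (G H : graph) : Prop :=
  exists f : G -> H, homomorphism f /\ locally_injective f.

Definition ltLI (G H : graph) : Prop := leLI G H /\ ~ leLI H G.

Definition equitable (G : graph) (P : {set {set G}}) : bool :=
  partition P [set: G] &&
  [forall B in P, forall C in P, forall u in B, forall v in B,
    #|nbr u :&: C| == #|nbr v :&: C|].

Definition coarsest_equitable (G : graph) (P : {set {set G}}) : bool :=
  equitable P &&
  [forall Q : {set {set G}},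
    equitable Q ==> [forall B in Q, exists C in P, B \subset C]].

Lemma equitableP (G : graph) (P : {set {set G}}) :
  reflect (partition P [set: G] /\
           forall B C u v, B \in P -> C \in P -> u \in B -> v \in B ->
             #|nbr u :&: C| = #|nbr v :&: C|)
          (equitable P).
Proof.
apply: (iffP andP) => -[pP h]; split=> //.
  move=> B C u v BP CP uB vB; apply/eqP.
  by move: h => /forall_inP/(_ B BP)/forall_inP/(_ C CP)
                /forall_inP/(_ u uB)/forall_inP/(_ v vB).
apply/forall_inP=> B BP; apply/forall_inP=> C CP; apply/forall_inP=> u uB.
by apply/forall_inP=> v vB; apply/eqP; apply: h BP CP uB vB.
Qed.

Lemma card_partitionI (T : finType) (P : {set {set T}}) (A : {set T}) :
  partition P [set: T] -> #|A| = \sum_(D in P) #|A :&: D|.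
Proof.
move=> /and3P[/eqP cP tP _].
rewrite -sum1_card big_mkcond /=.
have -> : \sum_i (if i \in A then 1 else 0)
        = \sum_(i in cover P) (if i \in A then 1 else 0).
  by apply: eq_bigl => i; rewrite cP inE.
rewrite (big_trivIset _ tP); apply: eq_bigr => D _.
by rewrite -sum1_card -big_mkcondr; apply: eq_bigl => i; rewrite inE andbC.
Qed.

Lemma coarsest_equitable_exists (G : graph) :
  exists P : {set {set G}}, coarsest_equitable P.
Proof.
pose e (x y : G) :=
  [exists P : {set {set G}}, equitable P && (pblock P x == pblock P y)].
have esym : connect_sym e.
  apply: sym_connect_sym => x y.
  by apply: eq_existsb => P; rewrite [_ == pblock P y]eq_sym.
have eR : {in [set: G] & &, equivalence_rel (connect e)}.
  by move=> x y z _ _ _; split=> [|xy]; [apply: connect0|apply: same_connect].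
pose P0 := equivalence_partition (connect e) [set: G].
have pP0 : partition P0 [set: G] := equivalence_partitionP eR.
have /and3P[/eqP cP0 tP0 nP0] := pP0.
have memP0 B x y : B \in P0 -> x \in B -> (y \in B) = connect e x y.
  move=> BP xB; rewrite -(def_pblock tP0 BP xB).
  by rewrite (pblock_equivalence_partition eR) ?inE.
have step C u v : C \in P0 -> e u v -> #|nbr u :&: C| = #|nbr v :&: C|.
  move=> CP /existsP[P /andP[/equitableP[pP eP] /eqP uv]].
  have /and3P[/eqP cP tP _] := pP.
  have inP x : pblock P x \in P by rewrite pblock_mem // cP inE.
  have self x : x \in pblock P x by rewrite mem_pblock cP inE.
  rewrite !(card_partitionI _ pP); apply: eq_bigr => D DP.
  have [CD0|[x /setIP[xC xD]]] := set_0Vmem (C :&: D).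
    by rewrite -!setIA CD0 !setI0 !cards0.
  have DC : D \subset C.
    apply/subsetP=> y yD; rewrite (memP0 C x y CP xC); apply: connect1.
    apply/existsP; exists P; apply/andP; split; first exact/equitableP.
    by rewrite (def_pblock tP DP xD) (def_pblock tP DP yD).
  rewrite -!setIA (setIidPr DC).
  by apply: (eP (pblock P u) D u v (inP u) DP (self u)); rewrite uv self.
exists P0; apply/andP; split.
  apply/equitableP; split=> // B C u v BP CP uB vB.
  move: vB; rewrite (memP0 B u v BP uB) => /connectP[p].
  elim: p u {uB} => [|w p IHp] u /=; first by move=> _ ->.
  by case/andP=> euw pw lw; rewrite (step C u w CP euw); apply: IHp.
apply/forallP=> Q; apply/implyP=> eQ; apply/forall_inP=> B BQ.
have /equitableP[/and3P[_ tQ nQ] _] := eQ.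
have [B0|[x xB]] := set_0Vmem B; first by rewrite B0 (negPf nQ) in BQ.
apply/exists_inP; exists (pblock P0 x); first by rewrite pblock_mem // cP0 inE.
apply/subsetP=> y yB; rewrite (pblock_equivalence_partition eR) ?inE //.
apply: connect1; apply/existsP; exists Q.
by rewrite eQ (def_pblock tQ BQ xB) (def_pblock tQ BQ yB) /=.
Qed.

Lemma coarsest_equitable_unique (G : graph) (P Q : {set {set G}}) :
  coarsest_equitable P -> coarsest_equitable Q -> P = Q.
Proof.
suff sub (P' Q' : {set {set G}}) :
    coarsest_equitable P' -> coarsest_equitable Q' -> P' \subset Q'.
  by move=> hP hQ; apply/eqP; rewrite eqEsubset !sub.
move=> /andP[eP /forallP/(_ Q')/implyP mP].
move=> /andP[eQ /forallP/(_ P')/implyP/(_ eP)/forall_inP mQ].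
apply/subsetP=> B BP; have /exists_inP[C CQ BC] := mQ B BP.
have /exists_inP[B' BP' CB'] := forall_inP (mP eQ) C CQ.
have /equitableP[/and3P[_ tP nP] _] := eP.
have [B0|[x xB]] := set_0Vmem B; first by rewrite B0 (negPf nP) in BP.
have BB' : B = B'.
  by rewrite -(def_pblock tP BP xB) (def_pblock tP BP' (subsetP CB' _ (subsetP BC _ xB))).
suff -> : B = C by [].
by apply/eqP; rewrite eqEsubset BC BB'.
Qed.

Definition drp (G : graph) : {set {set G}} :=
  xchoose (coarsest_equitable_exists G).

Lemma drpP (G : graph) : coarsest_equitable (drp G).
Proof. exact: xchooseP. Qed.

Definition block (G : graph) (i : 'I_#|drp G|) : {set G} := enum_val i.

(* Blocks are listed in the arbitrary order of enum_val, so only the class of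
   this matrix under simultaneous row and column permutations is meaningful.
   By drmE, the entries do not depend on the representative u. *)
Definition drm (G : graph) : 'M[nat]_#|drp G| :=
  \matrix_(i, j)
    if [pick u in block i] is Some u then #|nbr u :&: block j| else 0.

Lemma drmE (G : graph) (i j : 'I_#|drp G|) (u : G) :
  u \in block i -> drm G i j = #|nbr u :&: block j|.
Proof.
move=> ui; rewrite mxE; case: pickP => [v vi|/(_ u)]; last by rewrite ui.
have /andP[/equitableP[_ h] _] := drpP G.
exact: (h _ _ _ _ (enum_valP i) (enum_valP j) vi ui).
Qed.

Definition same_drm (G H : graph) : Prop :=
  exists2 s : 'I_#|drp G| -> 'I_#|drp H|,
    bijective s & forall i j, drm G i j = drm H (s i) (s j).

(* Main.v *)
(* A locally injective f : G -> H does not decrease the number of walks of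
   length n leaving a vertex.  If H has a map back to G that does not decrease
   these numbers either (as it has when drm(G) = drm(H) or H <=LI G), then f
   preserves them, hence all degrees.  So one vertex v with deg v < deg (f v)
   makes G and H differ in the required sense, and if there is no such v then f
   is a covering and drm(G) = drm(H).  It remains to find F with locally
   injective maps G -> F -> H that both lose degree at some vertex.

   Let v lose degree under f, and let y be a neighbour of f v that is not the
   image of a neighbour of v.  For (a), attach to v a pendant vertex over y; it
   has degree 1, unlike y.  For (b), attach to v a path over a walk in H
   starting with f v, y and ending in a cycle that runs several times around a
   closed walk: the cycle has one vertex of degree 3, where the path arrives,
   and another vertex of degree 2 over the same vertex of H.  The walks follow
   the faces of a cyclic ordering of the neighbours at each vertex of H, so they
   are closed and never backtrack; the branching takes place on returning to
   f v, which has degree at least 3.  If G is a single vertex, replace it first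
   by such a cycle. *)
Require Import Defs.
From mathcomp Require Import all_boot matrix.

Set Implicit Arguments.
Unset Strict Implicit.
Unset Printing Implicit Defensive.

(** * Walk counts *)

Fixpoint walks (G : graph) (n : nat) (v : G) : nat :=
  if n is m.+1 then \sum_(w in nbr v) walks m w else 1.

Lemma walks1 (G : graph) (v : G) : walks 1 v = deg v.
Proof. by rewrite /= sum1_card. Qed.

Lemma sub_imset_nbr (G H : graph) (f : G -> H) (v : G) :
  homomorphism f -> f @: nbr v \subset nbr (f v).
Proof.
move=> homf; apply/subsetP=> _ /imsetP[w vw ->].
by move: vw; rewrite !inE; apply: homf.
Qed.

(** Keeping [f w] inside the sum gives a value between [walks n.+1 v] and [walks n.+1 (f v)]; when
    these two agree, it agrees with both. *)
Lemma walksS_le (G H : graph) (f : G -> H) (n : nat) (v : G) :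
  homomorphism f -> locally_injective f ->
  \sum_(w in nbr v) walks n (f w) <= walks n.+1 (f v).
Proof.
move=> homf injf; rewrite -(big_imset (fun w => walks n w) (injf v)) /=.
rewrite [leqRHS](big_setID (f @: nbr v)) /=.
by rewrite (setIidPr (sub_imset_nbr v homf)) leq_addr.
Qed.

Lemma walks_le (G H : graph) (f : G -> H) (n : nat) (v : G) :
  homomorphism f -> locally_injective f -> walks n v <= walks n (f v).
Proof.
move=> homf injf; elim: n v => // n IHn v.
by apply: leq_trans (walksS_le n v homf injf); apply: leq_sum => w _.
Qed.

Lemma deg_le (G H : graph) (f : G -> H) (v : G) :
  homomorphism f -> locally_injective f -> deg v <= deg (f v).
Proof. by move=> homf injf; rewrite -!walks1; apply: walks_le. Qed.

Lemma exists_periodic (T : finType) (f : T -> T) (x0 : T) :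
  exists x n, iter n.+1 f x = x.
Proof.
have /trajectP[i lti eqi] := looping_order f x0.
exists (iter i f x0), (order f x0 - i).-1.
by rewrite prednK ?subn_gt0 // -iterD subnK // ltnW.
Qed.

(* On a cycle of phi \o f the walk counts are squeezed, so f preserves them at
   some vertex; preservation then spreads along the edges. *)
Lemma locally_injective_deg (G H : graph) (f : G -> H) (phi : H -> G) :
  connected G -> homomorphism f -> locally_injective f ->
  (forall n w, walks n w <= walks n (phi w)) -> forall v, deg (f v) = deg v.
Proof.
move=> connG homf injf le_phi v.
have [x0 _] := card_gt0P (vertex_gt0 G).
pose psi := phi \o f.
have le_psi n w : walks n w <= walks n (psi w).
  exact: leq_trans (walks_le n w homf injf) (le_phi n (f w)).
have [x [k xK]] := exists_periodic psi x0.
have le_iter n m w : walks n w <= walks n (iter m psi w).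
  by elim: m => //= m IHm; apply: leq_trans IHm (le_psi _ _).
have eqx n : walks n (f x) = walks n x.
  apply/eqP; rewrite eqn_leq walks_le // andbT.
  apply: leq_trans (le_phi n (f x)) _.
  (* Splitting off the first [psi] leaves [k] further steps from [psi x] back to [x]. *)
  by rewrite -[in leqRHS]xK iterSr; apply: le_iter.
have spread u w : (forall n, walks n (f u) = walks n u) -> adj u w ->
    forall n, walks n (f w) = walks n w.
  move=> equ uw n; apply/esym/eqP.
  (* Equal counts of length [n.+1] at [u] force equal sums of counts of length [n] over its
     neighbours, hence equality in every term. *)
  have sumP : \sum_(z in nbr u) walks n z <= \sum_(z in nbr u) walks n (f z)
      ?= iff [forall (z | z \in nbr u), walks n z == walks n (f z)].
    by apply: leqif_sum => z _; split; first exact: walks_le.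
  have /forall_inP-> // : [forall (z | z \in nbr u), walks n z == walks n (f z)].
    rewrite -(geq_leqif sumP).
    by apply: leq_trans (walksS_le n u homf injf) _; rewrite equ.
  by rewrite inE.
have /connectP[p] := connG x v.
elim: p x eqx {xK} => [|y p IHp] x eqx /= => [_ ->|/andP[xy py]].
  by rewrite -!walks1 eqx.
exact: IHp (spread _ _ eqx xy) py.
Qed.

Lemma in_block (G : graph) (v : G) : exists i, v \in block i.
Proof.
have /andP[/equitableP[/and3P[/eqP cP _ _] _] _] := drpP G.
have bv : pblock (drp G) v \in drp G by rewrite pblock_mem // cP inE.
exists (enum_rank_in bv (pblock (drp G) v)).
by rewrite /block enum_rankK_in // mem_pblock cP inE.
Qed.

Lemma block_neq0 (G : graph) (i : 'I_#|drp G|) : exists v, v \in block i.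
Proof.
have /andP[/equitableP[/and3P[_ _ n0] _] _] := drpP G.
have [b0|[v vi]] := set_0Vmem (block i); last by exists v.
by move: n0; rewrite -b0 enum_valP.
Qed.

Lemma sum_nbr_blocks (G : graph) (v : G) (F : G -> nat) :
  \sum_(w in nbr v) F w = \sum_j \sum_(w in nbr v :&: block j) F w.
Proof.
have /andP[/equitableP[pP _] _] := drpP G.
transitivity (\sum_(w in [set: G] | w \in nbr v) F w).
  by apply: eq_bigl => w; rewrite in_setT.
rewrite (set_partition_big_cond _ pP) big_enum_val.
by apply: eq_bigr => j _; apply: eq_bigl => w; rewrite in_setI andbC.
Qed.

(** When the neighbours are grouped by block, induction makes the summand constant on each block, so
    only the matrix entries matter. *)
Lemma drm_walks (G H : graph) (s : 'I_#|drp G| -> 'I_#|drp H|) :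
  bijective s -> (forall i j, drm G i j = drm H (s i) (s j)) ->
  forall n i v w, v \in block i -> w \in block (s i) -> walks n v = walks n w.
Proof.
move=> bij_s eq_s; elim=> // n IHn i v w vi wi /=.
rewrite !sum_nbr_blocks (reindex s) /=; last exact: onW_bij.
apply: eq_bigr => j _.
have [x xj] := block_neq0 j; have [y yj] := block_neq0 (s j).
transitivity (\sum_(u in nbr v :&: block j) walks n y).
  by apply: eq_bigr => u /setIP[_ uj]; apply: IHn uj yj.
(* The induction hypothesis only compares [G] with [H], so constancy on [block (s j)] is obtained
   through [x] in [block j]. *)
transitivity (\sum_(u in nbr w :&: block (s j)) walks n y); last first.
  apply: eq_bigr => u /setIP[_ uj].
  by rewrite -(IHn j x y xj yj); apply: IHn xj uj.
by rewrite !sum_nat_const -(drmE j vi) -(drmE (s j) wi) eq_s.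
Qed.

Lemma same_drm_sym (G H : graph) : same_drm G H -> same_drm H G.
Proof.
case=> s [s' sK s'K] eq_s; exists s'; first by exists s.
by move=> i j; rewrite eq_s !s'K.
Qed.

Lemma same_drm_walks (G H : graph) :
  same_drm G H -> exists phi : G -> H, forall n v, walks n v = walks n (phi v).
Proof.
case=> s bij_s eq_s.
have /fin_all_exists[phi phiP] :
    forall v : G, exists w : H, forall n, walks n v = walks n w.
  move=> v; have [i vi] := in_block v; have [w wi] := block_neq0 (s i).
  by exists w => n; apply: drm_walks bij_s eq_s n i v w vi wi.
by exists phi => n v; apply: phiP.
Qed.

Lemma deficient_lt (G H : graph) (f : G -> H) (v : G) :
  connected G -> homomorphism f -> locally_injective f -> deg v < deg (f v) ->
  [/\ ltLI G H, ~ same_drm G H & ~ same_drm H G].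
Proof.
move=> connG homf injf ltv.
have noback (phi : H -> G) : ~ (forall n w, walks n w <= walks n (phi w)).
  move=> le_phi.
  by move: ltv; rewrite (locally_injective_deg connG homf injf le_phi) ltnn.
have nHG : ~ same_drm H G.
  by case/same_drm_walks=> phi eq_phi; apply: (noback phi) => n w; rewrite eq_phi.
split=> //; last by move=> /same_drm_sym.
split; first by exists f.
by case=> g [homg injg]; apply: (noback g) => n w; apply: walks_le.
Qed.

(** * Coverings preserve the degree refinement *)

Definition block_index (G : graph) (v : G) : 'I_#|drp G| := xchoose (in_block v).

Lemma mem_block (G : graph) (v : G) (i : 'I_#|drp G|) :
  (v \in block i) = (block_index v == i).
Proof.
have vb : v \in block (block_index v) := xchooseP (in_block v).
apply/idP/eqP=> [vi|<-] //.
have /andP[/equitableP[/and3P[_ tP _] _] _] := drpP G.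
apply: enum_val_inj; move: vi vb; rewrite /block => vi vb.
by rewrite -(def_pblock tP (enum_valP _) vi) (def_pblock tP (enum_valP _) vb).
Qed.

Lemma block_index_surj (G : graph) (i : 'I_#|drp G|) :
  exists v : G, block_index v = i.
Proof. by have [v] := block_neq0 i; rewrite mem_block => /eqP; exists v. Qed.

Lemma drm_block_index (G : graph) (v : G) (j : 'I_#|drp G|) :
  drm G (block_index v) j = #|[set w in nbr v | block_index w == j]|.
Proof.
rewrite (@drmE _ _ _ v) ?mem_block //.
by apply: eq_card => w; rewrite !inE mem_block.
Qed.

(** The colour classes form an equitable partition, so each of them lies inside a block of the
    coarsest one. *)
Lemma equitable_coloring (G : graph) (C : finType) (c : G -> C) :
  (forall u v, c u = c v -> forall a,
     #|[set w in nbr u | c w == a]| = #|[set w in nbr v | c w == a]|) ->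
  forall u v, c u = c v -> block_index u = block_index v.
Proof.
move=> eq_c u v cuv; pose P := preim_partition c [set: G].
have pP : partition P [set: G] := preim_partitionP c [set: G].
have memP B x y : B \in P -> x \in B -> (y \in B) = (c y == c x).
  move=> BP xB; have /and3P[_ tP _] := pP.
  rewrite -(def_pblock tP BP xB) /P pblock_equivalence_partition ?inE 1?eq_sym //.
  by move=> a b d _ _ _; split=> // /eqP->.
have eP : equitable P.
  apply/equitableP; split=> // B D x y BP DP xB yB.
  have [z zD] : exists z, z \in D.
    have /and3P[_ _ n0] := pP.
    have [D0|[z zD]] := set_0Vmem D; last by exists z.
    by rewrite -D0 DP in n0.
  have cxy : c x = c y by apply/eqP; rewrite -(memP B y x BP yB).
  have setE w : nbr w :&: D = [set w' in nbr w | c w' == c z].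
    by apply/setP=> w'; rewrite !inE (memP D z w' DP zD).
  by rewrite !setE; apply: eq_c.
have /andP[_ /forallP/(_ P)/implyP/(_ eP)/forall_inP mP] := drpP G.
have /and3P[/eqP cP tP _] := pP.
have uP : pblock P u \in P by rewrite pblock_mem // cP inE.
have uB : u \in pblock P u by rewrite mem_pblock cP inE.
have /exists_inP[D DP sD] := mP _ uP.
have eqi x : x \in D -> block_index x = enum_rank_in DP D.
  by move=> xD; apply/eqP; rewrite -mem_block /block enum_rankK_in.
rewrite !eqi //; apply: (subsetP sD) => //.
by rewrite (memP _ u v uP uB) cuv.
Qed.

Section Covering.

Variables (G H : graph) (f : G -> H).
Hypotheses (connH : connected H) (homf : homomorphism f).
Hypotheses (injf : locally_injective f) (degf : forall v, deg (f v) = deg v).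

Lemma covering_imset_nbr (v : G) : f @: nbr v = nbr (f v).
Proof.
apply/eqP; rewrite eqEcard sub_imset_nbr //=.
by rewrite (card_in_imset (injf (v := v))) -[#|nbr (f v)|]/(deg (f v)) degf.
Qed.

(** A walk in [H] from [f x0] lifts to [G] edge by edge. *)
Lemma covering_surj (h : H) : exists v, f v = h.
Proof.
have [x0 _] := card_gt0P (vertex_gt0 G).
have /connectP[p] := connH (f x0) h.
elim: p x0 => [|y p IHp] x0 /=; first by move=> _ ->; exists x0.
case/andP=> xy; have : y \in f @: nbr x0 by rewrite covering_imset_nbr inE.
by case/imsetP=> z _ ->; apply: IHp.
Qed.

Lemma card_nbr_covering (v : G) (p : pred H) :
  #|[set w in nbr (f v) | p w]| = #|[set w in nbr v | p (f w)]|.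
Proof.
rewrite -(card_in_imset (f := f)); last first.
  by move=> x y /setIdP[vx _] /setIdP[vy _]; apply: injf vx vy.
congr #|pred_of_set _|; apply/setP=> w; rewrite inE -covering_imset_nbr.
apply/andP/imsetP=> [[/imsetP[x vx ->] px]|[x /setIdP[vx px] ->]].
  by exists x => //; apply/setIdP.
by split=> //; apply: imset_f.
Qed.

Lemma covering_same_drm : same_drm G H.
Proof.
have /fin_all_exists[sec secK] := covering_surj.
(* The blocks of [H], pulled back along [f], colour [G] equitably. *)
have down u v :
    block_index (f u) = block_index (f v) -> block_index u = block_index v.
  apply: (equitable_coloring (c := fun u => block_index (f u))) => x y exy a.
  rewrite -!(card_nbr_covering _ (fun w => block_index w == a)).
  by rewrite -!drm_block_index exy.
have bsec w : block_index (sec (f w)) = block_index w by apply: down; rewrite secK.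
(* Conversely, the blocks of [G], pulled back along the section, colour [H] equitably: by [bsec] the
   colour does not depend on the chosen preimage. *)
have up h h' : block_index (sec h) = block_index (sec h') ->
    block_index h = block_index h'.
  apply: (equitable_coloring (c := fun h => block_index (sec h))) => x y exy a.
  rewrite -[in LHS](secK x) -[in RHS](secK y) !card_nbr_covering.
  have setE z : [set w in nbr z | block_index (sec (f w)) == a]
      = [set w in nbr z | block_index w == a].
    by apply/setP=> w; rewrite !inE bsec.
  by rewrite !setE -!drm_block_index exy.
have up' u v :
    block_index u = block_index v -> block_index (f u) = block_index (f v).
  by move=> uv; apply: up; rewrite !bsec.
have /fin_all_exists[repG repGK] := @block_index_surj G.
have /fin_all_exists[repH repHK] := @block_index_surj H.
pose s i := block_index (f (repG i)).
have sE u : s (block_index u) = block_index (f u) by apply: up'.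
have sK : cancel s (fun j => block_index (sec (repH j))).
  by move=> i; rewrite -[RHS]repGK; apply: down; rewrite secK repHK.
have s'K : cancel (fun j => block_index (sec (repH j))) s.
  by move=> j; rewrite sE secK repHK.
exists s; first by exists (fun j => block_index (sec (repH j))).
move=> i j; rewrite -[i]repGK sE !drm_block_index.
rewrite (card_nbr_covering _ (fun w => block_index w == s j)).
congr #|pred_of_set _|; apply/setP=> w.
by rewrite !inE -sE (can_eq sK).
Qed.

End Covering.

(** * Building blocks: bridges and cycles *)

Section Join.

Variables (G T : graph) (v : G) (t : T).

(** Unlike the usual join of graphs, this adds a single bridge, so only the degrees of [v] and [t]
    change. *)
Definition join_adj : rel (G + T) := fun x y =>
  match x, y with
  | inl u, inl u' => adj u u'
  | inr w, inr w' => adj w w'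
  | inl u, inr w | inr w, inl u => (u == v) && (w == t)
  end.

Lemma join_adj_sym : symmetric join_adj.
Proof. by move=> [u|w] [u'|w'] //=; apply: adj_sym. Qed.

Lemma join_gt0 : 0 < #|{: G + T}|.
Proof. by rewrite card_sum addn_gt0 vertex_gt0. Qed.

Definition join : graph := Graph join_adj_sym join_gt0.

Lemma deg_sum (K : graph) (x : K) : deg x = \sum_y adj x y.
Proof.
rewrite /deg -sum1_card big_mkcond; apply: eq_bigr => y _.
by rewrite inE; case: adj.
Qed.

Lemma deg_join_inl (u : G) : @deg join (inl u) = deg u + (u == v).
Proof.
rewrite !deg_sum big_sumType /=; congr (_ + _).
rewrite (bigD1 t) //= eqxx andbT big1 ?addn0 // => w /negPf->.
by rewrite andbF.
Qed.

Lemma deg_join_inr (w : T) : @deg join (inr w) = deg w + (w == t).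
Proof.
rewrite !deg_sum big_sumType /= addnC; congr (_ + _).
by rewrite (bigD1 v) //= eqxx big1 ?addn0 // => u /negPf->.
Qed.

Lemma connected_join : connected G -> connected T -> connected join.
Proof.
move=> connG connT.
have conn_inl u u' : connect (@adj join) (inl u) (inl u').
  have /connectP[p] := connG u u'.
  elim: p u => [|y p IHp] u /= => [_ ->|/andP[uy py] lp]; first exact: connect0.
  by apply: connect_trans (IHp y py lp); apply: connect1.
have conn_inr w w' : connect (@adj join) (inr w) (inr w').
  have /connectP[p] := connT w w'.
  elim: p w => [|y p IHp] w /= => [_ ->|/andP[wy py] lp]; first exact: connect0.
  by apply: connect_trans (IHp y py lp); apply: connect1.
have conn_vt : connect (@adj join) (inl v) (inr t).
  by apply: connect1; rewrite /= !eqxx.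
have conn_lr u w : connect (@adj join) (inl u) (inr w).
  exact: connect_trans (conn_inl u v) (connect_trans conn_vt (conn_inr t w)).
move=> [u|w] [u'|w'] //.
by rewrite (sym_connect_sym (@adj_sym join)).
Qed.

Variables (H : graph) (f : G -> H) (k : T -> H).

Definition join_map (x : join) : H :=
  match x with inl u => f u | inr w => k w end.

Lemma join_map_homomorphism :
  homomorphism f -> homomorphism k -> adj (f v) (k t) -> homomorphism join_map.
Proof.
move=> homf homk vt [u|w] [u'|w'] /=; try by [apply: homf | apply: homk].
  by case/andP=> /eqP-> /eqP->.
by case/andP=> /eqP-> /eqP->; rewrite adj_sym.
Qed.

(** The bridge adds one neighbour at [v] and one at [t]; the last two hypotheses exclude a collision
    there. *)
Lemma join_map_locally_injective :
  locally_injective f -> locally_injective k ->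
  k t \notin f @: nbr v -> f v \notin k @: nbr t -> locally_injective join_map.
Proof.
move=> injf injk kt fv [u|w] [x|x] [y|y]; rewrite !inE /=.
- by move=> ux uy exy; congr inl; apply: (injf u); rewrite ?inE.
- move=> /[swap] /andP[/eqP-> /eqP->] vx exy.
  by rewrite -exy imset_f ?inE in kt.
- case/andP=> /eqP-> /eqP-> vy exy.
  by rewrite exy imset_f ?inE in kt.
- by case/andP=> _ /eqP-> /andP[_ /eqP->].
- by case/andP=> /eqP-> _ /andP[/eqP->].
- case/andP=> /eqP-> /eqP-> ty exy.
  by rewrite exy imset_f ?inE in fv.
- move=> /[swap] /andP[/eqP-> /eqP->] tx exy.
  by rewrite -exy imset_f ?inE in fv.
- by move=> wx wy exy; congr inr; apply: (injk w); rewrite ?inE.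
Qed.

Lemma join_cycle (c : seq T) :
  is_cycle c -> is_cycle (map (@inr G T) c : seq join).
Proof.
rewrite /is_cycle /ucycleb size_map cycle_map map_inj_uniq //.
by move=> w w' [].
Qed.

End Join.

Lemma singleton_adj_sym : symmetric (fun _ _ : unit => false).
Proof. by []. Qed.

Lemma singleton_gt0 : 0 < #|{: unit}|.
Proof. by rewrite card_unit. Qed.

Definition singleton : graph := Graph singleton_adj_sym singleton_gt0.

Lemma nbr_singleton (x : singleton) : nbr x = set0.
Proof. by apply/setP=> y; rewrite !inE. Qed.

Lemma deg_singleton (x : singleton) : deg x = 0.
Proof. by rewrite /deg nbr_singleton cards0. Qed.

Lemma connected_singleton : connected singleton.
Proof. by move=> [] []; apply: connect0. Qed.

Section CycleGraph.

Variables (m : nat).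
(** Length at least 3 keeps the two neighbours of a vertex distinct. *)
Let n := m.+3.

Definition cycle_adj : rel 'I_n := fun i j => (j == ordS i) || (i == ordS j).

Lemma cycle_adj_sym : symmetric cycle_adj.
Proof. by move=> i j; rewrite /cycle_adj orbC. Qed.

Lemma cycle_gt0 : 0 < #|'I_n|.
Proof. by rewrite card_ord. Qed.

Definition cycle_graph : graph := Graph cycle_adj_sym cycle_gt0.

Lemma nbr_cycle (i : cycle_graph) : nbr i = [set ordS i; ord_pred i] :> {set 'I_n}.
Proof.
apply/setP=> j; rewrite !inE; congr (_ || _).
by rewrite -(can2_eq (@ordSK n) (@ord_predK n)) eq_sym.
Qed.

Lemma ordS_neq_pred (i : 'I_n) : ordS i != ord_pred i.
Proof.
apply/negP=> /eqP/(congr1 (@ordS n)); rewrite ord_predK => /(congr1 val) /=.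
rewrite -addn1 modnDml addn1 -addn2 => eqi.
have : i + 2 = i + 0 %[mod n] by rewrite addn0 eqi modn_small.
by move=> /eqP; rewrite eqn_modDl.
Qed.

Lemma deg_cycle (i : cycle_graph) : deg i = 2.
Proof. by rewrite /deg nbr_cycle cards2 ordS_neq_pred. Qed.

Lemma val_iter_ordS (i : nat) : iter i (@ordS n) ord0 = i %% n :> nat.
Proof.
elim: i => [|i IHi] /=; first by rewrite mod0n.
by rewrite IHi -addn1 modnDml addn1.
Qed.

Lemma fconnect_ordS (i : 'I_n) : fconnect (@ordS n) ord0 i.
Proof.
have -> : i = iter i (@ordS n) ord0.
  by apply: val_inj; rewrite /= val_iter_ordS modn_small.
exact: fconnect_iter.
Qed.

Lemma connected_cycle : connected cycle_graph.
Proof.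
have conn0 i : connect (@adj cycle_graph) ord0 i.
  apply: connect_sub (fconnect_ordS i) => x y /eqP <-.
  by apply: connect1; rewrite /= /cycle_adj eqxx.
move=> i j; apply: connect_trans (conn0 j).
by rewrite (sym_connect_sym (@adj_sym cycle_graph)).
Qed.

Lemma cycle_graph_cycle :
  exists2 c : seq cycle_graph, is_cycle c & ord0 \in c.
Proof.
exists (orbit (@ordS n) ord0); last by rewrite -fconnect_orbit connect0.
apply/and3P; split; last exact: orbit_uniq.
  rewrite size_orbit /order.
  by rewrite (eq_card (B := predT)) ?card_ord // => i; rewrite !inE fconnect_ordS.
apply: sub_cycle (cycle_orbit (@ordS_inj n) ord0) => x y /eqP <-.
by rewrite /= /cycle_adj eqxx.
Qed.

End CycleGraph.

(** * Faces and tails *)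

(** After rotating [c] to start at [x], the successor of [x] is the second entry. *)
Lemma next_neq (T : eqType) (c : seq T) (x : T) :
  uniq c -> x \in c -> 1 < size c -> next c x != x.
Proof.
move=> uc xc; have [i s def_c] := rot_to xc.
rewrite -(next_rot i uc) -(size_rot i) def_c.
have : uniq (x :: s) by rewrite -def_c rot_uniq.
by case: s {def_c} => //= y s; rewrite inE negb_or eqxx eq_sym => /andP[/andP[]].
Qed.

(* A dart is an ordered pair of adjacent vertices; turning at its head
   according to a cyclic order of the neighbours there is a permutation of the
   darts, so following the turns always closes up without backtracking. *)
Definition turn (H : graph) (d : H * H) : H * H :=
  (d.2, next (enum (nbr d.2)) d.1).

(** This holds for all pairs, adjacent or not, since [prev] undoes [next] even off the list; hence
    every orbit of [turn] closes up. *)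
Lemma turn_inj (H : graph) : injective (@turn H).
Proof.
move=> [p q] [p' q'] [/= <-] eq_n; congr (_, _).
exact: (can_inj (prev_next (enum_uniq (nbr q)))) eq_n.
Qed.

Lemma adj_turn (H : graph) (d : H * H) :
  adj d.1 d.2 -> adj (turn d).1 (turn d).2.
Proof.
move=> ad; have : next (enum (nbr d.2)) d.1 \in enum (nbr d.2).
  by rewrite mem_next mem_enum inE adj_sym.
by rewrite mem_enum inE.
Qed.

Lemma adj_iter_turn (H : graph) (n : nat) (d : H * H) :
  adj d.1 d.2 -> adj (iter n (@turn H) d).1 (iter n (@turn H) d).2.
Proof. by move=> ad; elim: n => //= n /adj_turn. Qed.

Lemma no_deg1_gt1 (H : graph) (p q : H) : no_deg1 H -> adj p q -> 1 < deg p.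
Proof.
move=> degH pq; rewrite ltn_neqAle eq_sym; apply/andP; split.
  by apply/eqP/degH.
by apply/card_gt0P; exists q; rewrite inE.
Qed.

Lemma turn_neq (H : graph) (d : H * H) :
  no_deg1 H -> adj d.1 d.2 -> (turn d).2 != d.1.
Proof.
move=> degH ad; apply: next_neq; rewrite ?enum_uniq //.
  by rewrite mem_enum inE adj_sym.
by rewrite -cardE; apply: (no_deg1_gt1 (q := d.1)) => //; rewrite adj_sym.
Qed.

(* The face of d is traversed three times: this makes the cycle long enough and
   puts a second vertex over d.1. *)
Lemma face_cycle (H : graph) (d : H * H) : no_deg1 H -> adj d.1 d.2 ->
  exists m (k : cycle_graph m -> H),
    [/\ homomorphism k, locally_injective k, k ord0 = d.1,
        k @: nbr (ord0 : cycle_graph m) = [set d.2; prev (enum (nbr d.1)) d.2]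
      & exists2 u, u != ord0 & k u = d.1].
Proof.
move=> degH ad; set o := order (@turn H) d.
have o0 : 0 < o := order_gt0 _ _.
have oK : iter o (@turn H) d = d := iter_order (@turn_inj H) d.
pose m := (o * 3).-1.-1.-1.
have nE : m.+3 = o * 3 by rewrite /m; case: (o) o0 => // o' _; rewrite mulSn.
have nK : iter m.+3 (@turn H) d = d by rewrite nE mulnC iterM iter_fix.
(* [e] runs through the darts of the face and [k] takes their starting points, so the neighbours of
   [i] lie over the next and the previous vertex of the closed walk. *)
pose e (i : cycle_graph m) := iter (i : 'I_m.+3) (@turn H) d.
have eS (i : 'I_m.+3) : e (ordS i) = turn (e i).
  rewrite -[turn _]/(iter i.+1 (@turn H) d) /e.
  have -> : ordS i = i.+1 %% m.+3 :> nat by [].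
  have := ltn_ord i; rewrite leq_eqVlt => /orP[/eqP|] lti.
    by rewrite lti modnn nK.
  by rewrite modn_small.
have adj_e i : adj (e i).1 (e i).2 by apply: adj_iter_turn.
pose k (i : cycle_graph m) := (e i).1.
have kS (i : 'I_m.+3) : k (ordS i) = (e i).2 by rewrite /k eS.
have kP (i : 'I_m.+3) : k (ord_pred i) = prev (enum (nbr (e i).1)) (e i).2.
  by rewrite -{2 3}[i]ord_predK eS /= (prev_next (enum_uniq _)).
have k_neq (i : 'I_m.+3) : k (ordS i) != k (ord_pred i).
  by rewrite kS -{1}[i]ord_predK eS; apply: turn_neq.
have homk : homomorphism k.
  have adjS (i : 'I_m.+3) : adj (k i) (k (ordS i)) by rewrite kS; apply: adj_e.
  by move=> i j /orP[/eqP->|/eqP->] //; rewrite adj_sym.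
exists m, k; split=> //.
- move=> i x y; rewrite nbr_cycle !inE => /orP[/eqP->|/eqP->] /orP[/eqP->|/eqP->] //.
    by move/eqP; rewrite (negPf (k_neq i)).
  by move/esym/eqP; rewrite (negPf (k_neq i)).
- by rewrite nbr_cycle imsetU1 imset_set1 kS kP.
(* Position [o] is reached after one full round, so it lies over [d.1] again. *)
have lto : o < m.+3 by rewrite nE -{1}[o]muln1 ltn_pmul2l.
exists (Ordinal lto : cycle_graph m); last by rewrite /k /e /= oK.
by rewrite -val_eqE /= -lt0n.
Qed.

(* A graph over H with a vertex t over q, to be joined to a vertex over p: the
   terms (u == t) anticipate the degree increase at t. *)
Definition tail (H : graph) (p q : H) : Prop :=
  exists (T : graph) (t : T) (k : T -> H),
    [/\ connected T, homomorphism k, locally_injective k, k t = q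
      & p \notin k @: nbr t] /\
    [/\ forall u, 1 < deg u + (u == t),
        exists u, deg u + (u == t) < deg (k u)
      & exists c : seq T,
          is_cycle c /\ exists2 u, u \in c & 2 < deg u + (u == t)].

(** The tail is the cycle over the face of [(q, r)], attached at [ord0]: there the degree becomes 3,
    while the second vertex over [q] keeps degree 2, less than [deg q]. *)
Lemma tail_face (H : graph) (p q r : H) : no_deg1 H -> adj q r -> 2 < deg q ->
  p != r -> p != prev (enum (nbr q)) r -> tail p q.
Proof.
move=> degH qr deg_q pr pr'.
have [m [k [homk injk k0 nk [u u0 ku]]]] := face_cycle (d := (q, r)) degH qr.
have [c cyc c0] := cycle_graph_cycle m.
exists (cycle_graph m), ord0, k; split; split=> //.
- exact: connected_cycle.
- by rewrite nk !inE negb_or pr.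
- by move=> w; rewrite deg_cycle.
- by exists u; rewrite deg_cycle (negPf u0) ku.
- by exists c; split=> //; exists ord0; rewrite // deg_cycle eqxx.
Qed.

Lemma locally_injective_singleton (H : graph) (f : singleton -> H) :
  homomorphism f /\ locally_injective f.
Proof. by split=> // x y z; rewrite nbr_singleton inE. Qed.

(** A new vertex over [q] is put in front of the tail; it gets degree 2, one edge on each side, and
    [p != r] keeps their images distinct. *)
Lemma tail_step (H : graph) (p q r : H) :
  adj q r -> p != r -> tail q r -> tail p q.
Proof.
move=> qr pr [T [t [k [[connT homk injk kt qt] [degT [u ltu] [c [cyc [w wc ltw]]]]]]]].
pose f (_ : singleton) := q.
have [homf injf] := locally_injective_singleton f.
pose J := join (tt : singleton) t.
exists J, (inl tt), (join_map f k); split; split=> //.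
- exact: connected_join connected_singleton connT.
- by apply: join_map_homomorphism => //; rewrite kt.
- apply: join_map_locally_injective => //.
  by rewrite nbr_singleton imset0 inE.
- apply/imsetP=> -[[x|x]]; rewrite inE //= => /eqP-> px.
  by rewrite px kt eqxx in pr.
- by case=> x; rewrite ?deg_join_inl ?deg_join_inr ?deg_singleton ?addn0 //; case: x.
- by exists (inr u); rewrite deg_join_inr addn0.
exists (map (@inr singleton T) c); split; first exact: join_cycle.
by exists (inr w); [apply: map_f | rewrite deg_join_inr addn0].
Qed.

Lemma tail_exists (H : graph) (p q : H) :
  no_deg1 H -> adj p q -> 2 < deg p -> tail p q.
Proof.
move=> degH pq deg_p.
(* A tail at a later dart of the face extends backwards along the face to [d]. *)
have back n d : adj d.1 d.2 ->
    tail (iter n (@turn H) d).1 (iter n (@turn H) d).2 -> tail d.1 d.2.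
  elim: n d => // n IHn d ad; rewrite iterSr => /IHn-/(_ (adj_turn ad)) td.
  apply: tail_step td; first exact: adj_turn.
  by rewrite eq_sym turn_neq.
(* One turn short of the full order is the last dart of the face, which returns to [p]. *)
pose d := (p, q); apply: (back (order (@turn H) d).-1 d) => //.
have := adj_iter_turn (order (@turn H) d).-1 (d := d) pq.
have : turn (iter (order (@turn H) d).-1 (@turn H) d) = d.
  by rewrite -iterS prednK ?order_gt0 // iter_order //; apply: turn_inj.
case: (iter _ _ _) => u p' [/= ->] def_q up.
have /card_gt0P[r] : 0 < #|nbr p :\: [set u; q]|.
  rewrite cardsD subn_gt0; apply: leq_ltn_trans deg_p.
  apply: leq_trans (subset_leq_card (subsetIr _ _)) _.
  by rewrite cards2; case: (_ != _).
rewrite !inE negb_or => /andP[/andP[ru rq] pr].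
apply: tail_face pr _ _ _ => //; first by rewrite eq_sym.
(* If [u] preceded [r] around [p], then [r] would be the successor of [u], which is [q]. *)
apply: contra rq => /eqP def_u.
by rewrite -def_q def_u next_prev // enum_uniq.
Qed.

(** * Intermediate graphs *)

Lemma deficient_nbr (G H : graph) (f : G -> H) (v : G) :
  deg v < deg (f v) -> exists2 y, adj (f v) y & y \notin f @: nbr v.
Proof.
move=> ltv; have /card_gt0P[y] : 0 < #|nbr (f v) :\: f @: nbr v|.
  rewrite cardsD subn_gt0; apply: leq_ltn_trans ltv.
  apply: leq_trans (subset_leq_card (subsetIr _ _)) _.
  exact: leq_imset_card.
by rewrite !inE => /andP[yv fy]; exists y.
Qed.

Lemma between (G F H : graph) (g : G -> F) (h : F -> H) (v : G) (x : F) :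
  connected G -> connected F ->
  homomorphism g -> locally_injective g -> deg v < deg (g v) ->
  homomorphism h -> locally_injective h -> deg x < deg (h x) ->
  [/\ connected F, ltLI G F, ltLI F H, ~ same_drm F G & ~ same_drm F H].
Proof.
move=> connG connF homg injg ltv homh injh ltx.
have [GF _ nFG] := deficient_lt connG homg injg ltv.
by have [FH nFH _] := deficient_lt connF homh injh ltx.
Qed.

Lemma inl_locally_injective (G T : graph) (v : G) (t : T) :
  locally_injective (inl : G -> join v t).
Proof. by move=> u x y _ _ []. Qed.

Lemma deg_join_gt (G T : graph) (v : G) (t : T) :
  deg v < deg (inl v : join v t).
Proof. by rewrite deg_join_inl eqxx addn1. Qed.

Lemma between_any_degree (G H : graph) (f : G -> H) (v : G) :
  connected G -> no_deg1 H -> homomorphism f -> locally_injective f ->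
  deg v < deg (f v) ->
  exists F : graph,
     [/\ connected F, ltLI G F, ltLI F H, ~ same_drm F G & ~ same_drm F H].
Proof.
move=> connG degH homf injf ltv; have [y fy yv] := deficient_nbr ltv.
pose k (_ : singleton) := y.
have [homk injk] := locally_injective_singleton k.
exists (join v (tt : singleton)).
apply: (between (F := join v (tt : singleton)) (g := inl)
  (h := join_map f k) (v := v) (x := inr tt)) => //.
- exact: connected_join connG connected_singleton.
- exact: inl_locally_injective.
- exact: deg_join_gt.
- exact: join_map_homomorphism.
- by apply: join_map_locally_injective => //; rewrite nbr_singleton imset0 inE.
(* The pendant vertex has degree 1, whereas [y] has the neighbour [f v] and thus degree at least
   2. *)
rewrite deg_join_inr deg_singleton /=; apply: (no_deg1_gt1 degH (q := f v)).
by rewrite adj_sym.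
Qed.

Lemma between_no_deg1 (G H : graph) (f : G -> H) (v : G) :
  connected G -> no_deg1 G -> no_deg1 H ->
  homomorphism f -> locally_injective f -> 0 < deg v < deg (f v) ->
  exists F : graph,
     [/\ connected F, ltLI G F, ltLI F H, ~ same_drm F G & ~ same_drm F H]
     /\ no_deg1 F /\ has_cycle_deg_gt2 F.
Proof.
move=> connG degG degH homf injf /andP[v0 ltv].
(* Hence [deg (f v)] is at least 3, which leaves room for the branching in [tail_exists]. *)
have v1 : 1 < deg v by rewrite ltn_neqAle v0 eq_sym andbT; apply/eqP/degG.
have [y fy yv] := deficient_nbr ltv.
have [T [t [k [[connT homk injk kt vt] [degT [u ltu] [c [cyc [w wc ltw]]]]]]]] :=
  tail_exists degH fy (leq_ltn_trans v1 ltv).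
exists (join v t); split; last split.
- apply: (between (F := join v t) (g := inl)
    (h := join_map f k) (v := v) (x := inr u)) => //.
  + exact: connected_join.
  + exact: inl_locally_injective.
  + exact: deg_join_gt.
  + by apply: join_map_homomorphism => //; rewrite kt.
  + by apply: join_map_locally_injective => //; rewrite kt.
  by rewrite deg_join_inr.
- move=> [x|x]; rewrite ?deg_join_inl ?deg_join_inr; last first.
    by move=> degx; have := degT x; rewrite degx.
  case: eqP => [->|_]; last by rewrite addn0; apply: degG.
  by move=> degv; move: v1; rewrite -ltnS -[(deg v).+1]addn1 degv.
exists (map (@inr G T) c); split; first exact: join_cycle.
by exists (inr w); [apply: map_f | rewrite deg_join_inr].
Qed.

Lemma connected_deg0 (G : graph) (v : G) :
  connected G -> deg v = 0 -> forall u : G, nbr u = set0.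
Proof.
move=> connG /cards0_eq nv u; have /connectP[[|x p] /=] := connG v u.
  by move=> _ ->.
by case/andP=> vx; have := in_set0 x; rewrite -nv inE vx.
Qed.

Lemma leLI_edgeless (G H : graph) (f : G -> H) :
  (forall u : G, nbr u = set0) -> homomorphism f /\ locally_injective f.
Proof.
move=> n0; split; last by move=> u x y; rewrite n0 inE.
by move=> u w uw; have := in_set0 w; rewrite -(n0 u) inE uw.
Qed.

Theorem theorem5p7p12 (G H : graph)
  (connG : connected G) (connH : connected H)
  (drmGH : ~ same_drm G H) (leGH : leLI G H) (degH : no_deg1 H) :
  (exists F : graph,
     [/\ connected F, ltLI G F, ltLI F H, ~ same_drm F G & ~ same_drm F H])
  /\
  (no_deg1 G -> has_cycle_deg_gt2 H ->
   exists F : graph,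
     [/\ connected F, ltLI G F, ltLI F H, ~ same_drm F G & ~ same_drm F H]
     /\ no_deg1 F /\ has_cycle_deg_gt2 F).
Proof.
case: leGH => f [homf injf].
have [v ltv] : exists v, deg v < deg (f v).
  apply/existsP; rewrite -[[exists v, _]]negbK negb_exists.
  apply/negP=> /forallP le_f; apply: drmGH.
  apply: (covering_same_drm connH homf injf) => v.
  by apply/eqP; rewrite eqn_leq deg_le // andbT leqNgt.
split; first exact: between_any_degree ltv.
move=> degG [c [_ [a _ deg_a]]].
have [v0|v0] := posnP (deg v); last first.
  by apply: (between_no_deg1 (f := f) (v := v)) => //; rewrite v0.
have /card_gt0P[b] : 0 < #|nbr a| by apply: leq_trans deg_a.
rewrite inE => ab.
(* Here [G] has no edges; a cycle through a vertex over [a], of degree 2 below [deg a], takes its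
   place in the construction of [F]. *)
have [m [k [homk injk k0 _ _]]] := face_cycle (d := (a, b)) degH ab.
have degC : no_deg1 (cycle_graph m) by move=> w; rewrite deg_cycle.
have [|F [[connF [[g [homg injg]] _] FH _ nFH] [degF cycF]]] :=
    between_no_deg1 (v := ord0 : cycle_graph m) (connected_cycle (m := m))
      degC degH homk injk.
  by rewrite deg_cycle k0.
exists F; split=> //; have [d [_ [x _ degx]]] := cycF.
(* To compare [G] itself with [F], a constant map suffices: its value has degree greater than 2,
   while [deg v] is 0. *)
have [homx injx] := leLI_edgeless (fun _ : G => x) (connected_deg0 connG v0).
have [|GF _ nFG] := deficient_lt connG homx injx (v := v).
  by rewrite v0; apply: leq_trans degx.
by split.
Qed.
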